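(* Let $N\in\mathbb{N}$, $\tau\in\mathbb{N}_0$, let $r\le-\tau$ be an integer, and for each $i\in\{1,\ldots,N\}$ let $c_i:\mathbb{N}_0\to(-1,1)$ and $h_i:\mathbb{N}_0\times X^N\to\mathbb{R}$ be functions. Consider the difference equation $$x_i(m+1)=c_i(m)\,x_i(m-\tau)+h_i(m,\overline{x}_m),\qquad m\in\mathbb{N}_0,\ i\in\{1,\ldots,N\}.\qquad (E)$$ Assume: (i) for each $i\in\{1,\ldots,N\}$ there is a function $H_i:\mathbb{N}_0\to(0,+\infty)$ such that $$|h_i(m,\overline\alpha)-h_i(m,\overline\beta)|\le H_i(m)\,\|\overline\alpha-\overline\beta\|\qquad\text{for all }\overline\alpha,\overline\beta\in X^N,\ m\in\mathbb{N}_0;$$ (ii) there is $c\in(0,1]$ such that $|c_i(m)|\le c$ for all $i\in\{1,\ldots,N\}$ and $m\in\mathbb{N}_0$, and $$\lambda:=\max_{i=1,\ldots,N}\ \max_{s=0,\ldots,\tau}\left[\sup_{n\in\mathbb{N}}\sum_{l=0}^{n-1}\left(\prod_{k=l+1}^{n-1}|c_i(k(\tau+1)+\tau-s)|\right)H_i(l(\tau+1)+\tau-s)\,c^{\,l+\frac{r-s-1}{\tau+1}-n+1}\right]<1.$$ Then, for any $\overline\alpha,\overline\beta\in X^N$, the solutions $\overline{x}(\cdot,\overline\alpha)$ and $\overline{x}(\cdot,\overline\beta)$ of (E) satisfy $$\|\overline{x}_m(\cdot,\overline\alpha)-\overline{x}_m(\cdot,\overline\beta)\|\le\frac{c^{\frac{r}{\tau+1}-1}}{1-\lambda}\left(c^{\frac{1}{\tau+1}}\right)^m\|\overline\alpha-\overline\beta\|\qquad\text{for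 all }m\in\mathbb{N}_0.$$
   Context: $\mathbb{N}=\{1,2,\ldots\}$, $\mathbb{N}_0=\mathbb{N}\cup\{0\}$. For $I\subseteq\mathbb{R}$, $I_{\mathbb{Z}}=I\cap\mathbb{Z}$. $X$ is the space of functions $\alpha:[r,0]_{\mathbb{Z}}\to\mathbb{R}$ with norm $\|\alpha\|=\max_{j=r,\ldots,0}|\alpha(j)|$. $X^N$ carries the norm $\|\overline\alpha\|=\max_{i=1,\ldots,N}\|\alpha_i\|$ for $\overline\alpha=(\alpha_1,\ldots,\alpha_N)$, and $\mathbb{R}^N$ the norm $|\overline y|=\max_i|y_i|$. For $\overline{x}=(x_1,\ldots,x_N):[r,+\infty)_{\mathbb{Z}}\to\mathbb{R}^N$ and $m\in\mathbb{N}_0$, $\overline{x}_m\in X^N$ is defined by $\overline{x}_m(j)=\overline{x}(m+j)$, $j=r,\ldots,0$. For $\overline\alpha\in X^N$, $\overline{x}(\cdot,\overline\alpha):[r,+\infty)_{\mathbb{Z}}\to\mathbb{R}^N$ is the unique solution of the equation with initial condition $\overline{x}_0=\overline\alpha$, and $\overline{x}_m(\cdot,\overline\alpha)$ is its segment at time $m$. A product with no factors equals $1$. *)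

(* Defs.v *)
From HB Require Import structures.
From mathcomp Require Import all_boot all_order all_algebra.
From mathcomp Require Import zify.
From mathcomp Require Import all_classical all_reals all_analysis.

Set Implicit Arguments.
Unset Strict Implicit.
Unset Printing Implicit Defensive.

Import Order.TTheory GRing.Theory Num.Theory.

Local Open Scope ring_scope.

(* The integer interval [r, 0]; it is empty when r > 0. *)
Record history (r : int) := History {
  hist_val :> int;
  _ : r <= hist_val <= 0
}.

HB.instance Definition _ (r : int) := [isSub for @hist_val r].
HB.instance Definition _ (r : int) := [Countable of history r by <:].

Definition history_rank (r : int) (j : history r) : 'I_(`|r|%N.+1) :=
  inord `|hist_val j|%N.

Definition history_unrank (r : int) (k : 'I_(`|r|%N.+1)) : option (history r) :=
  insub (- (k : nat)%:Z).

Lemma history_rankK (r : int) :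
  pcancel (@history_rank r) (@history_unrank r).
Proof.
move=> j; rewrite /history_unrank /history_rank; case: j => j jP /=.
rewrite inordK; last by lia.
have -> : - (`|j|%N)%:Z = j by lia.
by rewrite insubT.
Qed.

HB.instance Definition _ (r : int) :=
  fintype.isFinite.Build (history r) (pcan_enumP (@history_rankK r)).

Notation phase_space R r := {ffun history r -> R}.
Notation phase_product R r N := {ffun 'I_N -> {ffun history r -> R}}.

(* In the two norms the default value 0 of the iterated maximum is harmless,
   the terms being nonnegative. *)
Definition phase_norm (R : realType) (r : int) (alpha : phase_space R r) : R :=
  \big[Num.max/0]_(j : history r) `|alpha j|.

Definition phase_product_norm (R : realType) (r : int) (N : nat)
    (alpha : phase_product R r N) : R :=
  \big[Num.max/0]_(i < N) phase_norm (alpha i).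

(* Trajectories on [r, +oo) are functions on all of int; their values at
   times t < r are never used. *)
Definition segment (R : realType) (r : int) (N : nat)
    (x : 'I_N -> int -> R) (m : nat) : phase_product R r N :=
  [ffun i => [ffun j : history r => x i (m%:Z + hist_val j)]].

Definition is_solution (R : realType) (N tau : nat) (r : int)
    (c : 'I_N -> nat -> R) (h : 'I_N -> nat -> phase_product R r N -> R)
    (alpha : phase_product R r N) (x : 'I_N -> int -> R) : Prop :=
  segment r x 0 = alpha /\
  forall (m : nat) (i : 'I_N),
    x i (m.+1)%:Z = c i m * x i (m%:Z - tau%:Z) + h i m (segment r x m).

Definition lambda_sum (R : realType) (N tau : nat) (r : int)
    (c H : 'I_N -> nat -> R) (c0 : R) (i : 'I_N) (s n : nat) : R :=
  \sum_(0 <= l < n)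
    (\prod_(l.+1 <= k < n) `|c i (k * tau.+1 + tau - s)%N|)
    * H i (l * tau.+1 + tau - s)%N
    * c0 `^ (l%:R + (r%:~R - s%:R - 1) / tau.+1%:R - n%:R + 1).

(* Extended-real valued, since the suprema may be infinite; the bottom element
   -oo is only the value of a maximum over the empty set. *)
Definition lambda (R : realType) (N tau : nat) (r : int)
    (c H : 'I_N -> nat -> R) (c0 : R) : \bar R :=
  \big[Order.max/-oo%E]_(i < N) \big[Order.max/-oo%E]_(s < tau.+1)
    ereal_sup [set (lambda_sum tau r c H c0 i s n)%:E | n in [set n | (0 < n)%N]].

(* Well-posedness of the initial value problem: for every initial segment a
   solution exists, and any two solutions agree on [r, +oo). *)
Section WellPosedness.
Variables (R : realType) (N tau : nat) (r : int).
Hypothesis r_le : r <= - tau%:Z.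
Variables (c : 'I_N -> nat -> R) (h : 'I_N -> nat -> phase_product R r N -> R).

Fixpoint approx (alpha : phase_product R r N) (n : nat) (i : 'I_N) (t : int) : R :=
  match n with
  | 0%N => if insub t is Some j then alpha i j else 0
  | m.+1 => let y := approx alpha m in
      if t == m.+1%:Z
      then c i m * y i (m%:Z - tau%:Z) + h i m (segment r y m) else y i t
  end.

Lemma approx_stable alpha (d m : nat) i (t : int) :
  t <= m%:Z -> approx alpha (d + m) i t = approx alpha m i t.
Proof.
move=> tm; elim: d => [//|d IH]; rewrite addSn /=.
by case: eqP => [e|_]; [exfalso; lia | exact: IH].
Qed.

Lemma solution_exists alpha : exists x, is_solution tau c h alpha x.
Proof.
pose x i (t : int) := approx alpha `|Num.max t 0|%N i t.
have xE (m : nat) i (t : int) : t <= m%:Z -> x i t = approx alpha m i t.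
  move=> tm; rewrite /x.
  have e : (m = (m - `|Num.max t 0|) + `|Num.max t 0|)%N by lia.
  by rewrite [in RHS]e approx_stable //; lia.
have segE m : segment r x m = segment r (approx alpha m) m.
  apply/ffunP => i; apply/ffunP => -[j jP]; rewrite !ffunE /=.
  by apply: xE; lia.
exists x; split.
  apply/ffunP => i; apply/ffunP => j; rewrite segE !ffunE /= add0r.
  by rewrite valK.
move=> m i; rewrite (xE m.+1) //= eqxx segE; congr (_ * _ + _).
by rewrite (xE m) //; lia.
Qed.

Lemma solution_unique alpha x y :
  is_solution tau c h alpha x -> is_solution tau c h alpha y ->
  forall i (t : int), r <= t -> x i t = y i t.
Proof.
move=> [x0 xS] [y0 yS].
have agree (m : nat) i (t : int) : r <= t <= m%:Z -> x i t = y i t.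
  elim: m i t => [|m IH] i t tP.
    have /ffunP/(_ i)/ffunP/(_ (History tP)) : segment r x 0 = segment r y 0.
      by rewrite x0 y0.
    by rewrite !ffunE /= !add0r.
  have [tm|tm] : t <= m%:Z \/ t = m.+1%:Z by lia.
    by apply: IH; lia.
  rewrite tm xS yS IH; last by lia.
  congr (_ + h i m _).
  apply/ffunP => i'; apply/ffunP => -[j jP]; rewrite !ffunE /=.
  by apply: IH; lia.
by move=> i t rt; apply: (agree `|t|%N); lia.
Qed.

End WellPosedness.

(* Main.v *)
Require Import Defs.
From HB Require Import structures.
From mathcomp Require Import all_boot all_order all_algebra.
From mathcomp Require Import zify lra.
From mathcomp Require Import all_classical all_reals all_analysis.

(** Put T = tau + 1, q = c0^(1/T) and let L be the constant lambda.  The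
    equation couples times that differ by T, so the half-line of positive
    times splits into the T progressions nT - s with 0 <= s <= tau.  Along each
    of them the difference e of two solutions satisfies a first-order linear
    inequality, which the variation of constants formula
    ([variation_of_constants_le]) solves:

      e (nT - s) <= c0^n e (- s)
        + sum_(l < n) (prod_(l < k < n) |c_k|) H_l |segment at lT + tau - s|.

    Let A be the distance of the initial segments and suppose that e t <= M q^t
    at all earlier times.  As q <= 1, the segment at time t is at most
    M q^(t + r), and the exponent of c0 in the definition of lambda is exactly
    the one that turns the resulting sum into M q^(nT) times the sum defining
    lambda ([lambda_sum_rescale]).  Hence

      e (nT - s) <= A q^(nT) + L M q^(nT) <= (A + L M) q^(nT - s),

    and the induction closes when A + L M = M, that is M = A / (1 - L)
    ([solution_difference_le]).  Passing from values to segments costs the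
    factor q^r, which is at most c0^(r/T - 1). *)

Import Order.TTheory GRing.Theory Num.Theory.

Local Open Scope ring_scope.

(** * Norms on the phase space *)

Lemma ler_norm_phase_product (R : realType) (r : int) (N : nat)
    (alpha : phase_product R r N) (i : 'I_N) (j : history r) :
  `|alpha i j| <= phase_product_norm alpha.
Proof.
apply: (@le_trans _ _ (phase_norm (alpha i))); first exact: le_bigmax.
exact: (le_bigmax _ (fun i => phase_norm (alpha i))).
Qed.

Lemma phase_product_norm_le (R : realType) (r : int) (N : nat)
    (alpha : phase_product R r N) (b : R) :
  0 <= b -> (forall i j, `|alpha i j| <= b) -> phase_product_norm alpha <= b.
Proof. by move=> b0 ab; apply: bigmax_le => // i _; apply: bigmax_le. Qed.

Lemma phase_product_norm_ge0 (R : realType) (r : int) (N : nat)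
    (alpha : phase_product R r N) : 0 <= phase_product_norm alpha.
Proof. exact: bigmax_ge_id. Qed.

(** * Powers and a linear difference inequality *)

Lemma ler_exprz_anti (R : realType) (q : R) (a b : int) :
  0 < q <= 1 -> a <= b -> q ^ b <= q ^ a.
Proof.
move=> /andP[q0 q1] ab; have -> : b = a + `|b - a|%N%:Z by lia.
rewrite expfzDr ?gt_eqF// ler_piMr ?exprz_ge0 ?(ltW q0)//.
by apply: exprn_ile1 => //; exact: ltW.
Qed.

(** Reduces the real powers of c0 to integer powers of the rate q = c0^(1/d). *)
Lemma powR_root (R : realType) (c0 : R) (z : int) (d : nat) :
  c0 `^ (z%:~R / d%:R) = (c0 `^ (1 / d%:R)) ^ z.
Proof. by rewrite -powR_intmul ?powR_ge0// -powRrM mulrC div1r. Qed.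

Lemma variation_of_constants_le (R : realType) (a b e : nat -> R) (n : nat) :
  (forall k, 0 <= a k) -> (forall k, (k < n)%N -> e k.+1 <= a k * e k + b k) ->
  e n <= (\prod_(0 <= k < n) a k) * e 0%N
         + \sum_(0 <= l < n) (\prod_(l.+1 <= k < n) a k) * b l.
Proof.
move=> a0; elim: n => [|n IH] step; first by rewrite !big_geq// mul1r addr0.
apply: (le_trans (step n (ltnSn n))).
rewrite [\prod_(0 <= k < n.+1) _]big_nat_recr//=.
rewrite [\sum_(0 <= l < n.+1) _]big_nat_recr//=.
rewrite [\prod_(n.+1 <= k < n.+1) _]big_geq// mul1r addrA lerD2r.
have -> : \sum_(0 <= l < n) \prod_(l.+1 <= k < n.+1) a k * b l
    = a n * \sum_(0 <= l < n) \prod_(l.+1 <= k < n) a k * b l.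
  rewrite mulr_sumr !big_nat; apply: eq_bigr => l /andP[_ ln].
  by rewrite big_nat_recr//= mulrAC mulrC.
rewrite mulrAC [_ * a n]mulrC -mulrDr ler_wpM2l ?a0//.
by apply: IH => k kn; apply: step; exact: ltnW.
Qed.

(** * The sums defining lambda *)

(** With T = tau + 1 and q = c0^(1/T), the power of c0 in [lambda_sum] is
    q^((lT + tau - s) + r - nT): it compares the decay at the oldest entry,
    of time lT + tau - s + r, of the segment that enters the l-th term with
    the decay at time nT. *)
Lemma lambda_sum_rescale (R : realType) (N tau : nat) (r : int)
    (c H : 'I_N -> nat -> R) (c0 : R) (i : 'I_N) (s n : nat) :
  0 < c0 -> (s <= tau)%N ->
  \sum_(0 <= l < n)
    (\prod_(l.+1 <= k < n) `|c i (k * tau.+1 + tau - s)%N|)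
    * (H i (l * tau.+1 + tau - s)%N
       * (c0 `^ (1 / tau.+1%:R)) ^ ((l * tau.+1 + tau - s)%N%:Z + r))
  = lambda_sum tau r c H c0 i s n
    * (c0 `^ (1 / tau.+1%:R)) ^ (n * tau.+1)%N%:Z.
Proof.
move=> c0_gt0 s_tau; rewrite /lambda_sum mulr_suml; apply: eq_bigr => l _.
rewrite -!mulrA; congr (_ * (_ * _)).
rewrite -!powR_root -powRD; last by rewrite (gt_eqF c0_gt0) implybT.
congr (_ `^ _).
have T0 : tau.+1%:R != 0 :> R by rewrite pnatr_eq0.
have := divfK T0 (r%:~R - s%:R - 1); set u := (_ - _ - 1) / _ => uT.
apply: (mulIf T0); rewrite divfK//.
rewrite -addnBA// !intrD -!pmulrn natrD natrB// !natrM mulfK//.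
move: uT; rewrite -natr1 => uT; lra.
Qed.

Lemma lambda_sum_ge0 (R : realType) (N tau : nat) (r : int)
    (c H : 'I_N -> nat -> R) (c0 : R) (i : 'I_N) (s n : nat) :
  (forall m, 0 <= H i m) -> 0 <= lambda_sum tau r c H c0 i s n.
Proof.
move=> H0; apply: sumr_ge0 => l _.
by rewrite !mulr_ge0 ?powR_ge0// prodr_ge0.
Qed.

Lemma lambda_sum_le_lambda (R : realType) (N tau : nat) (r : int)
    (c H : 'I_N -> nat -> R) (c0 : R) (i : 'I_N) (s n : nat) :
  (s <= tau)%N -> (0 < n)%N ->
  ((lambda_sum tau r c H c0 i s n)%:E <= lambda tau r c H c0)%E.
Proof.
move=> s_tau n0.
pose S j k : set (\bar R) :=
  [set (lambda_sum tau r c H c0 j k p)%:E | p in [set p | (0 < p)%N]]%classic.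
apply: (@le_trans _ _ (ereal_sup (S i s))).
  by apply: ereal_sup_ubound; exists n.
have s_lt : (s < tau.+1)%N by [].
apply: (@le_trans _ _ (\big[Order.max/-oo%E]_(k < tau.+1) ereal_sup (S i k))).
  exact: (le_bigmax _ (fun k : 'I_tau.+1 => ereal_sup (S i k)) (Ordinal s_lt)).
exact: (le_bigmax _ (fun j =>
  \big[Order.max/-oo%E]_(k < tau.+1) ereal_sup (S j k)) i).
Qed.

(** * The difference of two solutions *)

Section Contraction.
Variables (R : realType) (N tau : nat) (r : int).
Hypothesis r_le : r <= - tau%:Z.
Variables (c : 'I_N -> nat -> R) (h : 'I_N -> nat -> phase_product R r N -> R).
Variable H : 'I_N -> nat -> R.
Hypothesis H_ge0 : forall i m, 0 <= H i m.
Hypothesis h_lip : forall i m (alpha beta : phase_product R r N),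
  `|h i m alpha - h i m beta| <= H i m * phase_product_norm (alpha - beta).
Variable c0 : R.
Hypothesis c0_bounds : 0 < c0 <= 1.
Hypothesis c_le : forall i m, `|c i m| <= c0.
Variables (alpha beta : phase_product R r N) (x y : 'I_N -> int -> R).
Hypothesis x_sol : is_solution tau c h alpha x.
Hypothesis y_sol : is_solution tau c h beta y.

Let q := c0 `^ (1 / tau.+1%:R).
Let A := phase_product_norm (alpha - beta).

Lemma decay_rate_bounds : 0 < q <= 1.
Proof.
have /andP[c0_gt0 c0_le1] := c0_bounds.
rewrite powR_gt0//=.
apply: (@le_trans _ _ (1 `^ (1 / tau.+1%:R))); last by rewrite powR1.
by apply: ge0_ler_powR; rewrite ?nnegrE ?(ltW c0_gt0) ?divr_ge0.
Qed.

Lemma initial_difference_le i (t : int) : r <= t <= 0 -> `|x i t - y i t| <= A.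
Proof.
move=> t_range; have [x0 _] := x_sol; have [y0 _] := y_sol.
have := ler_norm_phase_product _ _ _ (alpha - beta) i (History t_range).
by rewrite -{1}x0 -{1}y0 !ffunE /= !add0r.
Qed.

Lemma solution_difference_step i (m : nat) :
  `|x i m.+1%:Z - y i m.+1%:Z|
    <= `|c i m| * `|x i (m%:Z - tau%:Z) - y i (m%:Z - tau%:Z)|
       + H i m * phase_product_norm (segment r x m - segment r y m).
Proof.
have [_ xS] := x_sol; have [_ yS] := y_sol; rewrite xS yS.
rewrite opprD addrACA -mulrBr -normrM.
by apply: (le_trans (ler_normD _ _)); rewrite lerD2l.
Qed.

(** As q <= 1, the weakest of the bounds M q^t over a segment is the one at its
    oldest entry. *)
Lemma segment_difference_le (M : R) (m : nat) :
  0 <= M ->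
  (forall i (t : int), r <= t <= m%:Z -> `|x i t - y i t| <= M * q ^ t) ->
  phase_product_norm (segment r x m - segment r y m) <= M * q ^ (m%:Z + r).
Proof.
move=> M0 le_M; have /andP[q0 _] := decay_rate_bounds.
apply: phase_product_norm_le => [|i [j jP]].
  by rewrite mulr_ge0 ?exprz_ge0 ?(ltW q0).
rewrite !ffunE /=; apply: (le_trans (le_M _ _ _)); first by lia.
by rewrite ler_wpM2l// ler_exprz_anti ?decay_rate_bounds//; lia.
Qed.

Variable L : R.
Hypothesis L_ge0 : 0 <= L.
Hypothesis L_lt1 : L < 1.
Hypothesis lambda_sum_le : forall i s n, (s <= tau)%N -> (0 < n)%N ->
  lambda_sum tau r c H c0 i s n <= L.

(** Along the progression kT - s the equation is a first-order recursion whose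
    forcing term at step l is controlled by the past bound M; what the sum of
    these terms contributes is M times [lambda_sum], and the homogeneous part is
    at most c0^n A = q^(nT) A. *)
Lemma solution_difference_bootstrap (M : R) i (n s : nat) :
  0 <= M -> (s <= tau)%N -> (0 < n)%N ->
  (forall i (t : int), r <= t < (n * tau.+1)%N%:Z - s%:Z ->
     `|x i t - y i t| <= M * q ^ t) ->
  `|x i ((n * tau.+1)%N%:Z - s%:Z) - y i ((n * tau.+1)%N%:Z - s%:Z)|
    <= (A + L * M) * q ^ ((n * tau.+1)%N%:Z - s%:Z).
Proof.
move=> M0 s_tau n0 past; have /andP[c0_gt0 _] := c0_bounds.
have /andP[q0 _] := decay_rate_bounds.
pose e (k : nat) : R :=
  `|x i ((k * tau.+1)%N%:Z - s%:Z) - y i ((k * tau.+1)%N%:Z - s%:Z)|.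
pose a k := `|c i (k * tau.+1 + tau - s)%N|.
pose b l := M * (H i (l * tau.+1 + tau - s)%N
                 * q ^ ((l * tau.+1 + tau - s)%N%:Z + r)).
have a0 k : 0 <= a k by exact: normr_ge0.
have step k : (k < n)%N -> e k.+1 <= a k * e k + b k.
  (* The segment at kT + tau - s ends strictly before nT - s, within reach of
     the past bound. *)
  move=> kn; have := solution_difference_step i (k * tau.+1 + tau - s)%N.
  have -> : (k * tau.+1 + tau - s).+1%N%:Z = (k.+1 * tau.+1)%N%:Z - s%:Z by lia.
  have -> : (k * tau.+1 + tau - s)%N%:Z - tau%:Z = (k * tau.+1)%N%:Z - s%:Z.
    by lia.
  move=> /le_trans; apply; rewrite lerD2l /b mulrCA ler_wpM2l//.
  apply: segment_difference_le => // j t t_range; apply: past.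
  have : (k.+1 * tau.+1 <= n * tau.+1)%N by rewrite leq_mul2r kn orbT.
  lia.
have prod_le : \prod_(0 <= k < n) a k <= q ^ (n * tau.+1)%N%:Z.
  rewrite -powR_root -pmulrn natrM mulfK ?pnatr_eq0//.
  rewrite powR_mulrn ?(ltW c0_gt0)// -[n in leRHS]subn0 -prodr_const_nat.
  by apply: ler_prod => k _; rewrite normr_ge0 c_le.
have e0 : e 0%N <= A by apply: initial_difference_le; lia.
have sum_le : \sum_(0 <= l < n) (\prod_(l.+1 <= k < n) a k) * b l
    <= M * (L * q ^ (n * tau.+1)%N%:Z).
  under eq_bigr do rewrite mulrCA.
  rewrite -mulr_sumr ler_wpM2l// lambda_sum_rescale//.
  by rewrite ler_wpM2r ?exprz_ge0 ?(ltW q0)// lambda_sum_le.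
apply: (le_trans (variation_of_constants_le _ a b e n a0 step)).
apply: (@le_trans _ _ ((A + L * M) * q ^ (n * tau.+1)%N%:Z)).
  rewrite mulrDl lerD//; last by rewrite -mulrA mulrCA.
  by rewrite mulrC ler_pM ?normr_ge0 ?prodr_ge0.
rewrite ler_wpM2l ?ler_exprz_anti ?decay_rate_bounds//; last by lia.
by rewrite addr_ge0 ?mulr_ge0// phase_product_norm_ge0.
Qed.

(** Strong induction on time.  Nonpositive times start it: there the difference
    is at most A, while q^t >= 1 and A <= A / (1 - L). *)
Lemma solution_difference_le i (t : int) :
  r <= t -> `|x i t - y i t| <= A / (1 - L) * q ^ t.
Proof.
have L1 : 0 < 1 - L by rewrite subr_gt0.
have A0 : 0 <= A := phase_product_norm_ge0 _ _ _ _.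
set M := A / (1 - L).
have M0 : 0 <= M by rewrite divr_ge0// ltW.
(* M is the fixed point of the bootstrap. *)
have fixM : A + L * M = M.
  have : M * (1 - L) = A by rewrite divfK// gt_eqF.
  lra.
have [m] : exists m : nat, t <= m%:Z by exists `|t|%N; lia.
elim: m t i => [|m IH] t i tm rt.
  apply: (le_trans (initial_difference_le i t _)); first by lia.
  apply: (@le_trans _ _ M); first by rewrite -fixM lerDl mulr_ge0.
  by rewrite ler_peMr// (ler_exprz_anti _ _ t 0) ?decay_rate_bounds.
have [t_le|t_eq] : t <= m%:Z \/ t = m.+1%:Z by lia.
  exact: IH.
(* n = m / T + 1 and s = tau - m mod T, so that m + 1 = nT - s. *)
pose n := (m %/ tau.+1).+1; pose s := (tau - m %% tau.+1)%N.
have m_mod : (m %% tau.+1 <= tau)%N by rewrite -ltnS ltn_pmod.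
have tE : t = (n * tau.+1)%N%:Z - s%:Z.
  have := divn_eq m tau.+1; rewrite t_eq /n /s mulSn; lia.
rewrite tE -[X in X * _]fixM; apply: solution_difference_bootstrap => //.
  exact: leq_subr.
move=> j u u_range; apply: IH; lia.
Qed.

End Contraction.

(** * Exponential stability *)

Theorem theorem1 (R : realType) (N tau : nat) (r : int)
    (N_gt0 : (0 < N)%N) (r_le : r <= - tau%:Z)
    (c : 'I_N -> nat -> R) (h : 'I_N -> nat -> phase_product R r N -> R)
    (c_lt1 : forall (i : 'I_N) (m : nat), -1 < c i m < 1)
    (H : 'I_N -> nat -> R)
    (H_gt0 : forall (i : 'I_N) (m : nat), 0 < H i m)
    (h_lip : forall (i : 'I_N) (m : nat) (alpha beta : phase_product R r N),
      `|h i m alpha - h i m beta| <= H i m * phase_product_norm (alpha - beta))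
    (c0 : R) (c0_bounds : 0 < c0 <= 1)
    (c_le : forall (i : 'I_N) (m : nat), `|c i m| <= c0)
    (lambda_lt1 : (lambda tau r c H c0 < 1)%E)
    (alpha beta : phase_product R r N) (x y : 'I_N -> int -> R)
    (x_sol : is_solution tau c h alpha x)
    (y_sol : is_solution tau c h beta y)
    (m : nat) :
  phase_product_norm (segment r x m - segment r y m)
    <= c0 `^ (r%:~R / tau.+1%:R - 1) / (1 - fine (lambda tau r c H c0))
       * (c0 `^ (1 / tau.+1%:R)) ^+ m * phase_product_norm (alpha - beta).
Proof.
have H_ge0 i k : 0 <= H i k by exact: ltW.
have lam_ge i s n := lambda_sum_le_lambda _ _ tau r c H c0 i s n.
(* The maxima are over nonempty sets since 0 < N, so lambda is a real in
   [0, 1) and not the default -oo. *)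
have lam_ge0 : (0 <= lambda tau r c H c0)%E.
  apply: le_trans (lam_ge (Ordinal N_gt0) 0%N 1%N isT isT).
  by rewrite lee_fin lambda_sum_ge0.
have lamE : (fine (lambda tau r c H c0))%:E = lambda tau r c H c0.
  by rewrite fineK// ge0_fin_numE// (lt_trans lambda_lt1)// ltry.
move: lam_ge lam_ge0 lambda_lt1; rewrite -lamE /=.
move: (fine _) => L lam_ge; rewrite lee_fin lte_fin => L_ge0 L_lt1.
have L1 : 0 < 1 - L by rewrite subr_gt0.
have A0 := phase_product_norm_ge0 _ _ _ (alpha - beta).
have /andP[c0_gt0 c0_le1] := c0_bounds.
apply: le_trans (segment_difference_le _ _ tau r r_le c0 c0_bounds x y
  (phase_product_norm (alpha - beta) / (1 - L)) m _ _) _.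
- by rewrite divr_ge0// ltW.
- move=> i t /andP[rt _].
  apply: (solution_difference_le _ _ _ _ r_le c h H H_ge0 h_lip c0 c0_bounds
    c_le alpha beta x y x_sol y_sol L L_ge0 L_lt1 _ i t rt) => j s n s_tau n0.
  by rewrite -lee_fin lam_ge.
(* The bound obtained has q^r in place of the larger c0^(r/T - 1) = q^r / c0. *)
have powE : c0 `^ (r%:~R / tau.+1%:R - 1)
    = (c0 `^ (1 / tau.+1%:R)) ^ r / c0.
  rewrite powRD ?(gt_eqF c0_gt0) ?implybT// powR_root.
  by rewrite powRN powRr1 ?(ltW c0_gt0).
have /andP[q0 q1] := decay_rate_bounds _ tau c0 c0_bounds.
rewrite powE expfzDr ?gt_eqF//.
set q := c0 `^ _; set A := phase_product_norm _.
rewrite [leRHS](_ : _ = A / (1 - L) * (q ^ m%:Z * q ^ r) * c0^-1); last first.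
  by rewrite -exprnP; lra.
rewrite ler_peMr ?invf_ge1// !mulr_ge0 ?invr_ge0 ?exprz_ge0 ?(ltW q0)//.
exact: ltW.
Qed.
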